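(* Let $L=[h_1,\dots,h_6]$ be an angle-symmetric 6R linkage, with $\dim_{\mathbb{C}}K_{sym}<2$ and with a non-degenerate component $K_0\subset K_{sym}^+$ of $K_{sym}$ containing the initial configuration $(\infty,\infty,\infty)$. If the $\lambda$-matrix $\mathbf{M}^{\dagger}$ of $L$ has rank $r=4$, then $L$ is of cubic polynomial type.
   Context: Let $\mathbb{DH}$ be the algebra of dual quaternions, the 8-dimensional real algebra with basis $1,\mathbf i,\mathbf j,\mathbf k,\epsilon,\epsilon\mathbf i,\epsilon\mathbf j,\epsilon\mathbf k$, where $\mathbf i,\mathbf j,\mathbf k$ multiply as quaternions, $\epsilon$ is central and $\epsilon^2=0$; $\bar h$ denotes the conjugate of $h$ ($\mathbf i,\mathbf j,\mathbf k\mapsto-\mathbf i,-\mathbf j,-\mathbf k$, $\epsilon\mapsto\epsilon$). A (rotation) line is represented by $h\in\mathbb{DH}$ with $h^2=-1$; the rotation about it by angle $\phi$ is represented, up to nonzero real scalars, by $t-h$ with $t=\cot(\phi/2)\in\mathbb{R}\cup\{\infty\}$, where for $t=\infty$ the factor $t-h$ (and likewise $t+h$) is read as $1$. A 6R linkage is a tuple $L=[h_1,\dots,h_6]$ of dual quaternions with $h_i^2=-1$ for all $i$. Its configuration set $K_L$ is the set of $(t_1,\dots,t_6)\in(\mathbb{R}\cup\{\infty\})^6$ with $(t_1-h_1)(t_2-h_2)\cdots(t_6-h_6)\in\mathbb{R}\setminus\{0\}$. $K_{sym}$ is the subset of $K_L$ with $t_1=t_4$, $t_2=t_5$, $t_3=t_6$;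 its points are written $(t_1,t_2,t_3)$. $L$ is angle-symmetric if $K_{sym}$ is one-dimensional. $\dim_{\mathbb{C}}K_{sym}$ is the dimension of the set of complex solutions of the same conditions ($t_i\in\mathbb{C}\cup\{\infty\}$, product in $\mathbb{C}\setminus\{0\}$). A non-degenerate component of $K_{sym}$ is an irreducible one-dimensional component on which none of the coordinates $t_1,t_2,t_3$ is constant. For $(t_1,t_2,t_3)\in K_{sym}$ one has $(t_1-h_1)(t_2-h_2)(t_3-h_3)=\lambda(t_3+h_6)(t_2+h_5)(t_1+h_4)$ with $\lambda\in\{1,-1\}$; $K_{sym}^+$ is the subset of $K_{sym}$ where $\lambda=1$. In the polynomial ring $\mathbb{DH}[t]$ the variable $t$ commutes with the coefficients, and conjugation acts on coefficients. $L=[h_1,\dots,h_6]$ is of cubic polynomial type if there are $a_i,b_i\in\mathbb{R}$ with $b_i\ne0$ ($i=1,\dots,6$) such that the linear polynomials $R_i(t)=t-a_i-b_ih_i$ satisfy $R_1R_2R_3=R_6R_5R_4$ and $R_1\overline{R_1}=R_4\overline{R_4}$, $R_2\overline{R_2}=R_5\overline{R_5}$, $R_3\overline{R_3}=R_6\overline{R_6}$. Put $g_i=h_i+h_{i+3}$ for $i=1,2,3$. The $\lambda$-matrix $\mathbf{M}^{\dagger}$ of $L$ is the $6\times 7$ matrix over $\mathbb{DH}$ $$\left[\begin{array}{ccccccc} g_3&g_2&g_1&h_5h_4-h_1h_2&h_6h_4-h_1h_3&h_6h_5-h_2h_3&h_6h_5h_4+h_1h_2h_3\\ g_3&g_2&g_1&h_1h_5-h_2h_4&h_1h_6-h_3h_4&h_6h_5-h_2h_3&h_1h_6h_5+h_2h_3h_4\\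 g_3&g_2&g_1&h_2h_1-h_4h_5&h_1h_6-h_3h_4&h_2h_6-h_3h_5&h_2h_1h_6+h_3h_4h_5\\ g_3&g_2&g_1&h_2h_1-h_4h_5&h_3h_1-h_4h_6&h_3h_2-h_5h_6&h_3h_2h_1+h_4h_5h_6\\ g_3&g_2&g_1&h_4h_2-h_5h_1&h_4h_3-h_6h_1&h_3h_2-h_5h_6&h_4h_3h_2+h_5h_6h_1\\ g_3&g_2&g_1&h_5h_4-h_1h_2&h_4h_3-h_6h_1&h_5h_3-h_6h_2&h_5h_4h_3+h_6h_1h_2 \end{array}\right].$$ It is regarded as a real $48\times 7$ matrix by replacing each entry by the column of its 8 real coordinates, and its rank is the real rank. *)

(* Defs.v *)
(* Mathematical Components world. *)
From HB Require Import structures.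
From mathcomp Require Import all_boot all_order all_algebra.
From mathcomp Require Import ring.
From mathcomp Require Import all_classical all_reals.
From mathcomp Require Import complex.
Set Implicit Arguments.
Unset Strict Implicit.
Unset Printing Implicit Defensive.
Import GRing.Theory.
Local Open Scope classical_set_scope.
Local Open Scope ring_scope.

Record quat (F : Type) : Type := Quat { qre : F; qi : F; qj : F; qk : F }.

Definition quat_tuple F (x : quat F) := (qre x, qi x, qj x, qk x).
Definition tuple_quat F (x : F * F * F * F) :=
  let: (a, b, c, d) := x in Quat a b c d.
Lemma quat_tupleK F : cancel (@quat_tuple F) (@tuple_quat F).
Proof. by case. Qed.

HB.instance Definition _ (F : choiceType) :=
  Choice.copy (quat F) (can_type (@quat_tupleK F)).

Section QuatAlgebra.
Variable F : comNzRingType.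
Implicit Types x y z : quat F.

Definition quat_zero : quat F := Quat 0 0 0 0.
Definition quat_opp x := Quat (- qre x) (- qi x) (- qj x) (- qk x).
Definition quat_add x y :=
  Quat (qre x + qre y) (qi x + qi y) (qj x + qj y) (qk x + qk y).
Definition quat_one : quat F := Quat 1 0 0 0.
Definition quat_mul x y :=
  Quat (qre x * qre y - qi x * qi y - qj x * qj y - qk x * qk y)
       (qre x * qi y + qi x * qre y + qj x * qk y - qk x * qj y)
       (qre x * qj y - qi x * qk y + qj x * qre y + qk x * qi y)
       (qre x * qk y + qi x * qj y - qj x * qi y + qk x * qre y).
Definition quat_scale (a : F) x :=
  Quat (a * qre x) (a * qi x) (a * qj x) (a * qk x).
Definition quat_conj x := Quat (qre x) (- qi x) (- qj x) (- qk x).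

Lemma quat_addA : associative quat_add.
Proof. by move=> x y z; rewrite /quat_add /= !addrA. Qed.
Lemma quat_addC : commutative quat_add.
Proof. by move=> x y; congr Quat; rewrite addrC. Qed.
Lemma quat_add0 : left_id quat_zero quat_add.
Proof. by case=> *; rewrite /quat_add /= !add0r. Qed.
Lemma quat_addN : left_inverse quat_zero quat_opp quat_add.
Proof. by case=> *; rewrite /quat_add /= !addNr. Qed.
HB.instance Definition _ :=
  GRing.isZmodule.Build (quat F) quat_addA quat_addC quat_add0 quat_addN.

Lemma quat_mulA : associative quat_mul.
Proof. by move=> x y z; congr Quat => /=; ring. Qed.
Lemma quat_mul1 : left_id quat_one quat_mul.
Proof. by case=> *; congr Quat => /=; ring. Qed.
Lemma quat_mulr1 : right_id quat_one quat_mul.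
Proof. by case=> *; congr Quat => /=; ring. Qed.
Lemma quat_mulDl : left_distributive quat_mul +%R.
Proof. by move=> x y z; congr Quat => /=; ring. Qed.
Lemma quat_mulDr : right_distributive quat_mul +%R.
Proof. by move=> x y z; congr Quat => /=; ring. Qed.
Lemma quat_one_neq0 : quat_one != 0.
Proof. by apply/eqP => -[/eqP]; rewrite oner_eq0. Qed.
HB.instance Definition _ := GRing.Zmodule_isNzRing.Build (quat F)
  quat_mulA quat_mul1 quat_mulr1 quat_mulDl quat_mulDr quat_one_neq0.

Lemma quat_scaleA a b x :
  quat_scale a (quat_scale b x) = quat_scale (a * b) x.
Proof. by rewrite /quat_scale /= !mulrA. Qed.
Lemma quat_scale1 : left_id 1 quat_scale.
Proof. by case=> *; rewrite /quat_scale /= !mul1r. Qed.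
Lemma quat_scaleDr : right_distributive quat_scale +%R.
Proof. by move=> a x y; rewrite /quat_scale /= !mulrDr. Qed.
Lemma quat_scaleDl x : {morph quat_scale^~ x : a b / a + b}.
Proof. by move=> a b; rewrite /quat_scale /= !mulrDl. Qed.
HB.instance Definition _ := GRing.Zmodule_isLmodule.Build F (quat F)
  quat_scaleA quat_scale1 quat_scaleDr quat_scaleDl.

Lemma quat_scaleAl (a : F) x y : a *: (x * y) = (a *: x) * y.
Proof. by congr Quat => /=; ring. Qed.
HB.instance Definition _ :=
  GRing.Lmodule_isLalgebra.Build F (quat F) quat_scaleAl.
Lemma quat_scaleAr (a : F) x y : a *: (x * y) = x * (a *: y).
Proof. by congr Quat => /=; ring. Qed.
HB.instance Definition _ :=
  GRing.Lalgebra_isAlgebra.Build F (quat F) quat_scaleAr.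

End QuatAlgebra.

(* [DQuat p d] is p + epsilon d, with epsilon central and epsilon^2 = 0. *)
Record dquat (F : Type) : Type := DQuat { dqp : quat F; dqd : quat F }.

Definition dquat_pair F (x : dquat F) := (dqp x, dqd x).
Definition pair_dquat F (x : quat F * quat F) := DQuat x.1 x.2.
Lemma dquat_pairK F : cancel (@dquat_pair F) (@pair_dquat F).
Proof. by case. Qed.

HB.instance Definition _ (F : choiceType) :=
  Choice.copy (dquat F) (can_type (@dquat_pairK F)).

Section DQuatAlgebra.
Variable F : comNzRingType.
Implicit Types x y z : dquat F.

Definition dquat_zero : dquat F := DQuat 0 0.
Definition dquat_opp x := DQuat (- dqp x) (- dqd x).
Definition dquat_add x y := DQuat (dqp x + dqp y) (dqd x + dqd y).
Definition dquat_one : dquat F := DQuat 1 0.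
Definition dquat_mul x y :=
  DQuat (dqp x * dqp y) (dqp x * dqd y + dqd x * dqp y).
Definition dquat_scale (a : F) x := DQuat (a *: dqp x) (a *: dqd x).
Definition dquat_conj x := DQuat (quat_conj (dqp x)) (quat_conj (dqd x)).

Lemma dquat_addA : associative dquat_add.
Proof. by move=> x y z; rewrite /dquat_add /= !addrA. Qed.
Lemma dquat_addC : commutative dquat_add.
Proof. by move=> x y; congr DQuat; rewrite addrC. Qed.
Lemma dquat_add0 : left_id dquat_zero dquat_add.
Proof. by case=> *; rewrite /dquat_add /= !add0r. Qed.
Lemma dquat_addN : left_inverse dquat_zero dquat_opp dquat_add.
Proof. by case=> *; rewrite /dquat_add /= !addNr. Qed.
HB.instance Definition _ :=
  GRing.isZmodule.Build (dquat F) dquat_addA dquat_addC dquat_add0 dquat_addN.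

Lemma dquat_mulA : associative dquat_mul.
Proof.
by move=> x y z; rewrite /dquat_mul /= mulrDr mulrDl !mulrA addrA.
Qed.
Lemma dquat_mul1 : left_id dquat_one dquat_mul.
Proof. by case=> *; rewrite /dquat_mul /= !mul1r mul0r addr0. Qed.
Lemma dquat_mulr1 : right_id dquat_one dquat_mul.
Proof. by case=> *; rewrite /dquat_mul /= !mulr1 mulr0 add0r. Qed.
Lemma dquat_mulDl : left_distributive dquat_mul +%R.
Proof. by move=> x y z; rewrite /dquat_mul /= !mulrDl; congr DQuat; rewrite addrACA. Qed.
Lemma dquat_mulDr : right_distributive dquat_mul +%R.
Proof. by move=> x y z; rewrite /dquat_mul /= !mulrDr; congr DQuat; rewrite addrACA. Qed.
Lemma dquat_one_neq0 : dquat_one != 0.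
Proof. by apply/eqP => -[/eqP]; rewrite oner_eq0. Qed.
HB.instance Definition _ := GRing.Zmodule_isNzRing.Build (dquat F)
  dquat_mulA dquat_mul1 dquat_mulr1 dquat_mulDl dquat_mulDr dquat_one_neq0.

Lemma dquat_scaleA a b x :
  dquat_scale a (dquat_scale b x) = dquat_scale (a * b) x.
Proof. by rewrite /dquat_scale /= !scalerA. Qed.
Lemma dquat_scale1 : left_id 1 dquat_scale.
Proof. by case=> *; rewrite /dquat_scale /= !scale1r. Qed.
Lemma dquat_scaleDr : right_distributive dquat_scale +%R.
Proof. by move=> a x y; rewrite /dquat_scale /= !scalerDr. Qed.
Lemma dquat_scaleDl x : {morph dquat_scale^~ x : a b / a + b}.
Proof. by move=> a b; rewrite /dquat_scale /= !scalerDl. Qed.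
HB.instance Definition _ := GRing.Zmodule_isLmodule.Build F (dquat F)
  dquat_scaleA dquat_scale1 dquat_scaleDr dquat_scaleDl.

Lemma dquat_scaleAl (a : F) x y : a *: (x * y) = (a *: x) * y.
Proof. by congr DQuat => /=; rewrite ?scalerDr !scalerAl. Qed.
HB.instance Definition _ :=
  GRing.Lmodule_isLalgebra.Build F (dquat F) dquat_scaleAl.
Lemma dquat_scaleAr (a : F) x y : a *: (x * y) = x * (a *: y).
Proof. by congr DQuat => /=; rewrite ?scalerDr !scalerAr. Qed.
HB.instance Definition _ :=
  GRing.Lalgebra_isAlgebra.Build F (dquat F) dquat_scaleAr.

(* Coordinates in the basis 1, i, j, k, eps, eps i, eps j, eps k. *)
Definition dquat_coord x (n : 'I_8) : F :=
  [:: qre (dqp x); qi (dqp x); qj (dqp x); qk (dqp x);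
      qre (dqd x); qi (dqd x); qj (dqd x); qk (dqd x)]`_n.

End DQuatAlgebra.

Definition quat_map F G (f : F -> G) (x : quat F) : quat G :=
  Quat (f (qre x)) (f (qi x)) (f (qj x)) (f (qk x)).
Definition dquat_map F G (f : F -> G) (x : dquat F) : dquat G :=
  DQuat (quat_map f (dqp x)) (quat_map f (dqd x)).

Section Dimension.
Variables (T : Type) (closed : set T -> Prop).
Implicit Types X Z : set T.

Definition irreducible_set Z :=
  Z !=set0 /\
  forall C1 C2, closed C1 -> closed C2 ->
    Z `<=` C1 `|` C2 -> Z `<=` C1 \/ Z `<=` C2.

Definition closed_in X Z := exists2 C, closed C & Z = X `&` C.

Definition irreducible_component X Z :=
  [/\ Z `<=` X, irreducible_set Z &
      forall W, W `<=` X -> irreducible_set W -> Z `<=` W -> W = Z].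

(* A chain C_0 < ... < C_n of irreducible closed subsets of X. *)
Definition krull_chain X (n : nat) (C : nat -> set T) :=
  (forall k, (k <= n)%N -> closed_in X (C k) /\ irreducible_set (C k)) /\
  (forall k, (k < n)%N -> C k `<` C k.+1).

Definition krull_dim_lt X (n : nat) := ~ exists C, krull_chain X n C.

Definition krull_dim_eq X (n : nat) :=
  (exists C, krull_chain X n C) /\ krull_dim_lt X n.+1.

End Dimension.

(* The projective line over F; [None] is the point at infinity. *)
Notation P1 F := (option F).
Definition P1cube (F : Type) : Type := P1 F * P1 F * P1 F.

Definition hcoord (F : nzRingType) (t : P1 F) : F * F :=
  if t is Some x then (x, 1) else (1, 0).

(* Value at t of the trihomogeneous polynomial of multidegree d with
   coefficients c, computed on the representatives [hcoord]; only its
   vanishing is meaningful. *)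
Definition triform_eval (F : comNzRingType) (d : nat * nat * nat)
    (c : nat -> nat -> nat -> F) (t : P1cube F) : F :=
  let: (d1, d2, d3) := d in
  let: (x1, y1) := hcoord t.1.1 in
  let: (x2, y2) := hcoord t.1.2 in
  let: (x3, y3) := hcoord t.2 in
  \sum_(i < d1.+1) \sum_(j < d2.+1) \sum_(k < d3.+1)
    c i j k * (x1 ^+ i * y1 ^+ (d1 - i)) * (x2 ^+ j * y2 ^+ (d2 - j))
            * (x3 ^+ k * y3 ^+ (d3 - k)).

Definition zariski_closed (F : comNzRingType) (Z : set (P1cube F)) : Prop :=
  exists S : set ((nat * nat * nat) * (nat -> nat -> nat -> F)),
    Z = [set t | forall p, S p -> triform_eval p.1 p.2 t = 0].

Definition is_6R (F : comNzRingType) (L : 6.-tuple (dquat F)) : Prop :=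
  forall i, tnth L i ^+ 2 = -1.

(* The i-th axis h_i, numbered from 1. *)
Definition axis (F : comNzRingType) (L : 6.-tuple (dquat F)) (i : nat) :
  dquat F := L`_(i.-1).

(* t - h; note that t + h is [rot_factor t (- h)]. *)
Definition rot_factor (F : comNzRingType) (t : P1 F) (h : dquat F) : dquat F :=
  if t is Some x then x%:A - h else 1.

Definition K_conf (F : comNzRingType) (L : 6.-tuple (dquat F)) :
    set (6.-tuple (P1 F)) :=
  [set t | exists2 c : F, c != 0 &
     \prod_(i < 6) rot_factor (tnth t i) (tnth L i) = c%:A].

Definition K_sym (F : comNzRingType) (L : 6.-tuple (dquat F)) :
    set (P1cube F) :=
  [set t | K_conf L [tuple t.1.1; t.1.2; t.2; t.1.1; t.1.2; t.2]].

Definition K_sym_plus (F : comNzRingType) (L : 6.-tuple (dquat F)) :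
    set (P1cube F) :=
  let h (i : nat) := axis L i in
  K_sym L `&`
  [set t | rot_factor t.1.1 (h 1%N) * rot_factor t.1.2 (h 2%N)
             * rot_factor t.2 (h 3%N) =
           rot_factor t.2 (- h 6%N) * rot_factor t.1.2 (- h 5%N)
             * rot_factor t.1.1 (- h 4%N)].

Definition angle_symmetric (R : realType) (L : 6.-tuple (dquat R)) : Prop :=
  krull_dim_eq (@zariski_closed R) (K_sym L) 1.

Local Open Scope complex_scope.

Definition complexify (R : realType) (L : 6.-tuple (dquat R)) :
    6.-tuple (dquat R[i]) :=
  map_tuple (dquat_map (real_complex R)) L.

Definition nondegenerate_component (R : realType) (L : 6.-tuple (dquat R))
    (K0 : set (P1cube R)) : Prop :=
  [/\ irreducible_component (@zariski_closed R) (K_sym L) K0,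
      krull_dim_eq (@zariski_closed R) K0 1,
      ~ (exists c, forall t, K0 t -> t.1.1 = c),
      ~ (exists c, forall t, K0 t -> t.1.2 = c) &
      ~ (exists c, forall t, K0 t -> t.2 = c)].

Definition cubic_polynomial_type (R : realType) (L : 6.-tuple (dquat R)) :
    Prop :=
  exists a b : 6.-tuple R,
    let r (i : nat) : {poly dquat R} :=
      'X - ((a`_i.-1)%:A)%:P - (b`_i.-1 *: axis L i)%:P in
    let N (p : {poly dquat R}) := p * map_poly (@dquat_conj R) p in
    [/\ forall i, tnth b i != 0,
        r 1%N * r 2%N * r 3%N = r 6%N * r 5%N * r 4%N,
        N (r 1%N) = N (r 4%N), N (r 2%N) = N (r 5%N) & N (r 3%N) = N (r 6%N)].

Definition lambda_mx (F : comNzRingType) (L : 6.-tuple (dquat F)) :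
    'M[dquat F]_(6, 7) :=
  let h1 := axis L 1%N in let h2 := axis L 2%N in let h3 := axis L 3%N in
  let h4 := axis L 4%N in let h5 := axis L 5%N in let h6 := axis L 6%N in
  let g1 := h1 + h4 in let g2 := h2 + h5 in let g3 := h3 + h6 in
  let rows := [::
    [:: g3; g2; g1; h5 * h4 - h1 * h2; h6 * h4 - h1 * h3; h6 * h5 - h2 * h3;
        h6 * h5 * h4 + h1 * h2 * h3];
    [:: g3; g2; g1; h1 * h5 - h2 * h4; h1 * h6 - h3 * h4; h6 * h5 - h2 * h3;
        h1 * h6 * h5 + h2 * h3 * h4];
    [:: g3; g2; g1; h2 * h1 - h4 * h5; h1 * h6 - h3 * h4; h2 * h6 - h3 * h5;
        h2 * h1 * h6 + h3 * h4 * h5];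
    [:: g3; g2; g1; h2 * h1 - h4 * h5; h3 * h1 - h4 * h6; h3 * h2 - h5 * h6;
        h3 * h2 * h1 + h4 * h5 * h6];
    [:: g3; g2; g1; h4 * h2 - h5 * h1; h4 * h3 - h6 * h1; h3 * h2 - h5 * h6;
        h4 * h3 * h2 + h5 * h6 * h1];
    [:: g3; g2; g1; h5 * h4 - h1 * h2; h4 * h3 - h6 * h1; h5 * h3 - h6 * h2;
        h5 * h4 * h3 + h6 * h1 * h2]] in
  \matrix_(i < 6, j < 7) (nth [::] rows i)`_j.

(* The (8 m) x n matrix of real coordinates of a dual quaternion matrix. *)
Definition coord_mx (F : comNzRingType) (m n : nat)
    (A : 'M[dquat F]_(m, n)) : 'M[F]_(\sum_(i < m) 8, n) :=
  \mxcol_(i < m) \matrix_(k < 8, j < n) dquat_coord (A i j) k.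

(* Main.v *)
(** By the six cyclic forms of the closure equation, the vector of monomials in
    [t1, t2, t3] lies in the kernel of the lambda-matrix at the affine points of
    K0, so rank 4 makes any four of the seven functions [1, t1, t2, t3, t1 t2,
    t1 t3, t2 t3] linearly dependent on K0. Applied to [1, x, y, x y], this
    makes any two coordinates either affinely related or related by [(x - c) (y
    - b) = k] with [k <> 0]; in the second case, comparing poles with the third
    coordinate produces four independent functions among the seven. So [t2 = p
    t1 + q] and [t3 = u t1 + v] on K0, and the closure equation, which holds for
    infinitely many values of [t1], is a polynomial identity in [t1]. Dividing
    it by [p u] gives the cubic factorization, with [b4 = - b1], [b5 = - b2],
    [b6 = - b3]. *)
Require Import Defs.
From HB Require Import structures.
From mathcomp Require Import all_boot all_order all_algebra.
From mathcomp Require Import ring.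
From mathcomp Require Import all_classical all_reals.
From mathcomp Require Import complex.
Import GRing.Theory Num.Theory.
Local Open Scope classical_set_scope.
Local Open Scope ring_scope.
Local Open Scope complex_scope.

Set Implicit Arguments.
Unset Strict Implicit.
Unset Printing Implicit Defensive.

(** * Polynomials with infinitely many roots *)

Definition infinite_pred (F : eqType) (S : F -> Prop) : Prop :=
  forall s : seq F, exists2 x, S x & x \notin s.

(** Points of [S] picked one at a time outside the earlier ones give [size p] distinct roots, one
    more than the degree of a nonzero [p] allows. *)
Lemma infinite_roots_eq0 (F : idomainType) (S : F -> Prop) (p : {poly F}) :
  infinite_pred S -> (forall x, S x -> p.[x] = 0) -> p = 0.
Proof.
move=> infS pS; apply/eqP/negPn/negP => p_neq0.
have [s [sz_s uniq_s root_s]] :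
    exists s, [/\ size s = size p, uniq s & all (root p) s].
  elim: (size p) => [|n [s [sz_s uniq_s root_s]]]; first by exists [::].
  have [x Sx x_s] := infS s; exists (x :: s).
  by rewrite /= sz_s x_s uniq_s root_s rootE pS ?eqxx.
by have := max_poly_roots p_neq0 root_s uniq_s; rewrite sz_s ltnn.
Qed.

Lemma infinite_cubic_eq0 (F : idomainType) (S : F -> Prop) (a0 a1 a2 a3 : F) :
  infinite_pred S ->
  (forall x, S x -> a0 + a1 * x + a2 * x ^+ 2 + a3 * x ^+ 3 = 0) ->
  [/\ a0 = 0, a1 = 0, a2 = 0 & a3 = 0].
Proof.
move=> infS aS; pose p := Poly [:: a0; a1; a2; a3].
have p0 : p = 0.
  apply: (@infinite_roots_eq0 _ S) => // x Sx; rewrite -[RHS](aS x Sx).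
  by rewrite horner_Poly /=; ring.
have coefp_eq0 i : [:: a0; a1; a2; a3]`_i = 0 by rewrite -coef_Poly -/p p0 coef0.
by split; [exact: (coefp_eq0 0%N) | exact: (coefp_eq0 1%N)
  | exact: (coefp_eq0 2%N) | exact: (coefp_eq0 3%N)].
Qed.

(** * Linear dependences and the relations between two coordinates *)

Section AffineRelation.
Variable F : fieldType.
Implicit Types A : F -> F -> F -> Prop.

(** Equivalently, [A] is not covered by finitely many planes on which one coordinate is constant. *)
Definition generic A : Prop := forall s1 s2 s3 : seq F, exists x y z,
  [/\ A x y z, x \notin s1, y \notin s2 & z \notin s3].

Definition dependent A (u0 u1 u2 u3 : F -> F -> F -> F) : Prop :=
  exists c0 c1 c2 c3, ~ [/\ c0 = 0, c1 = 0, c2 = 0 & c3 = 0] /\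
  forall x y z, A x y z ->
    c0 * u0 x y z + c1 * u1 x y z + c2 * u2 x y z + c3 * u3 x y z = 0.

Definition affine_rel A : Prop :=
  exists a b, a != 0 /\ forall x y z, A x y z -> y = a * x + b.

Definition hyperbolic_rel A : Prop :=
  exists c b k, k != 0 /\ forall x y z, A x y z -> (x - c) * (y - b) = k.

Lemma generic_swap A : generic A -> generic (fun x z y => A x y z).
Proof.
by move=> genA s1 s3 s2; have [x [y [z []]]] := genA s1 s2 s3; exists x, z, y.
Qed.

Lemma dependent_swap A (u0 u1 u2 u3 : F -> F -> F -> F) :
  dependent A u0 u1 u2 u3 ->
  dependent (fun x z y => A x y z) (fun x z y => u0 x y z)
    (fun x z y => u1 x y z) (fun x z y => u2 x y z) (fun x z y => u3 x y z).
Proof.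
move=> [c0 [c1 [c2 [c3 [c_neq0 cA]]]]].
by exists c0, c1, c2, c3; split=> // x z y; exact: cA.
Qed.

(** For [c3 != 0], completing the product gives the hyperbolic form, and a zero constant would put
    [A] into two planes of constant coordinate. For [c3 = 0], genericity forces [c2] and the slope
    to be nonzero. *)
Lemma bilinear_rel A : generic A ->
  dependent A (fun _ _ _ => 1) (fun x _ _ => x) (fun _ y _ => y)
    (fun x y _ => x * y) ->
  affine_rel A \/ hyperbolic_rel A.
Proof.
move=> genA [c0 [c1 [c2 [c3 [c_neq0 cA]]]]].
have [c3_eq0|c3_neq0] := eqVneq c3 0; last first.
  right; exists (- (c2 / c3)), (- (c1 / c3)), (c1 * c2 / c3 ^+ 2 - c0 / c3).
  have relA x y z : A x y z ->
      (x - - (c2 / c3)) * (y - - (c1 / c3)) = c1 * c2 / c3 ^+ 2 - c0 / c3.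
    move=> /cA eqA; apply/eqP; rewrite -subr_eq0.
    have -> : (x - - (c2 / c3)) * (y - - (c1 / c3))
        - (c1 * c2 / c3 ^+ 2 - c0 / c3) =
      (c0 * 1 + c1 * x + c2 * y + c3 * (x * y)) / c3 by field.
    by rewrite eqA mul0r.
  split=> //; apply/eqP => k0.
  have [x [y [z [/relA]]]] := genA [:: - (c2 / c3)] [:: - (c1 / c3)] [::].
  rewrite k0 !inE => /eqP; rewrite mulf_eq0 !subr_eq0.
  by case/orP => ->.
subst c3; have [c2_eq0|c2_neq0] := eqVneq c2 0.
  subst c2; have [c1_eq0|c1_neq0] := eqVneq c1 0.
    have [x [y [z [/cA]]]] := genA [::] [::] [::].
    by rewrite c1_eq0 !mul0r mulr1 !addr0 => c0_eq0; case: c_neq0.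
  have [x [y [z [/cA eqA]]]] := genA [:: - (c0 / c1)] [::] [::].
  rewrite inE => /negP[]; apply/eqP.
  have -> : x = (c0 * 1 + c1 * x + 0 * y + 0 * (x * y)) / c1 - c0 / c1 by field.
  by rewrite eqA mul0r add0r.
have relA x y z : A x y z -> y = - (c1 / c2) * x + - (c0 / c2).
  move=> /cA eqA.
  have -> : y = (c0 * 1 + c1 * x + c2 * y + 0 * (x * y)) / c2
      + (- (c1 / c2) * x + - (c0 / c2)) by field.
  by rewrite eqA mul0r add0r.
left; exists (- (c1 / c2)), (- (c0 / c2)); split=> //.
apply/eqP => a0; have [x [y [z [/relA]]]] := genA [::] [:: - (c0 / c2)] [::].
by rewrite a0 mul0r add0r => ->; rewrite !inE eqxx.
Qed.

(** As functions of [x], [y] has a pole at [c] and [x * z] is a quadratic polynomial, so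
    [1, x, y, x * z] are independent. *)
Lemma affine_not_hyperbolic A : generic A ->
  hyperbolic_rel A -> affine_rel (fun x y z => A x z y) ->
  dependent A (fun _ _ _ => 1) (fun x _ _ => x) (fun _ y _ => y)
    (fun x _ z => x * z) ->
  False.
Proof.
move=> genA [c [b [k [k_neq0 hypA]]]] [m [n [m_neq0 affA]]].
move=> [c0 [c1 [c2 [c3 [c_neq0 cA]]]]].
pose S x := exists y z, A x y z.
have infS : infinite_pred S.
  move=> s; have [x [y [z [Axyz x_s _ _]]]] := genA s [::] [::].
  by exists x => //; exists y, z.
have [|eq0 eq1 eq2 eq3] := @infinite_cubic_eq0 _ S (c2 * k - c0 * c - c2 * b * c)
  (c0 - c1 * c + c2 * b - c3 * n * c) (c1 + c3 * n - c3 * m * c) (c3 * m) infS.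
  move=> x [y [z Axyz]]; have /esym := cA _ _ _ Axyz.
  (* Multiplying by [x - c] clears the pole of [y] and leaves a cubic in [x]. *)
  move/(congr1 ( *%R^~ (x - c))); rewrite mul0r => ->.
  by rewrite (affA _ _ _ Axyz) -(hypA _ _ _ Axyz); ring.
have c3_eq0 : c3 = 0.
  by apply/eqP; move/eqP: eq3; rewrite mulf_eq0 (negPf m_neq0) orbF.
have c1_eq0 : c1 = 0 by move: eq2; rewrite c3_eq0 !mul0r subr0 addr0.
have c2_eq0 : c2 = 0.
  apply: (mulIf k_neq0); rewrite mul0r.
  (* The right-hand side is the cubic evaluated at [c], where only the residue of [y] survives. *)
  have -> : c2 * k = (c2 * k - c0 * c - c2 * b * c)
      + c * (c0 - c1 * c + c2 * b - c3 * n * c) + (c1 + c3 * n) * c ^+ 2 by ring.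
  by rewrite eq0 eq1 c3_eq0 c1_eq0; ring.
by apply: c_neq0; split=> //; rewrite -eq1 c1_eq0 c2_eq0 c3_eq0; ring.
Qed.

(** If [c] and [e] differed, [y] and [z] would have simple poles at different values of [x], and
    [1, x, y, z] would be independent. *)
Lemma hyperbolic_poles_eq A (c b k e d l : F) : generic A ->
  k != 0 -> l != 0 ->
  (forall x y z, A x y z -> (x - c) * (y - b) = k) ->
  (forall x y z, A x y z -> (x - e) * (z - d) = l) ->
  dependent A (fun _ _ _ => 1) (fun x _ _ => x) (fun _ y _ => y)
    (fun _ _ z => z) ->
  c = e.
Proof.
move=> genA k_neq0 l_neq0 hypy hypz [c0 [c1 [c2 [c3 [c_neq0 cA]]]]].
apply/eqP/negPn/negP => ce_neq.
pose S x := exists y z, A x y z.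
have infS : infinite_pred S.
  move=> s; have [x [y [z [Axyz x_s _ _]]]] := genA s [::] [::].
  by exists x => //; exists y, z.
(* Lower coefficients of the relation times [(x - c) * (x - e)], with [y] and [z] eliminated; the
   leading one is [c1]. *)
pose a0 := c0 * c * e + c2 * (b * c * e - k * e) + c3 * (d * c * e - l * c).
pose a1 := - c0 * (c + e) + c1 * c * e + c2 * (k - b * c - b * e)
  + c3 * (l - d * e - d * c).
pose a2 := c0 - c1 * (c + e) + c2 * b + c3 * d.
have [|eq0 eq1 eq2 eq3] := @infinite_cubic_eq0 _ S a0 a1 a2 c1 infS.
  move=> x [y [z Axyz]]; have /esym := cA _ _ _ Axyz.
  move/(congr1 (fun u => u * (x - c) * (x - e))); rewrite !mul0r => ->.
  by rewrite /a0 /a1 /a2 -(hypy _ _ _ Axyz) -(hypz _ _ _ Axyz); ring.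
have c2_eq0 : c2 = 0.
  have kce_neq0 : k * (c - e) != 0 by rewrite mulf_neq0 // subr_eq0.
  apply: (mulIf kce_neq0); rewrite mul0r.
  (* Evaluation at [c] isolates the residue of [y]; evaluation at [e] below does the same for
     [z]. *)
  have -> : c2 * (k * (c - e)) = a0 + a1 * c + a2 * c ^+ 2 + c1 * c ^+ 3
    by rewrite /a0 /a1 /a2; ring.
  by rewrite eq0 eq1 eq2 eq3; ring.
have c3_eq0 : c3 = 0.
  have lec_neq0 : l * (e - c) != 0 by rewrite mulf_neq0 // subr_eq0 eq_sym.
  apply: (mulIf lec_neq0); rewrite mul0r.
  have -> : c3 * (l * (e - c)) = a0 + a1 * e + a2 * e ^+ 2 + c1 * e ^+ 3
    by rewrite /a0 /a1 /a2; ring.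
  by rewrite eq0 eq1 eq2 eq3; ring.
by apply: c_neq0; split=> //; rewrite -eq2 /a2 eq3 c2_eq0 c3_eq0; ring.
Qed.

(** A hyperbolic [y] excludes an affine [z]. If [z] is hyperbolic in [x] too, the poles agree, so
    [z] is affine in [y], and the same contradiction arises with [y] as parameter. *)
Lemma affine_rel_of_dependent A : generic A ->
  dependent A (fun _ _ _ => 1) (fun x _ _ => x) (fun _ y _ => y)
    (fun x y _ => x * y) ->
  dependent A (fun _ _ _ => 1) (fun x _ _ => x) (fun _ _ z => z)
    (fun x _ z => x * z) ->
  dependent A (fun _ _ _ => 1) (fun x _ _ => x) (fun _ y _ => y)
    (fun x _ z => x * z) ->
  dependent A (fun _ _ _ => 1) (fun _ y _ => y) (fun x _ _ => x)
    (fun _ y z => y * z) ->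
  dependent A (fun _ _ _ => 1) (fun x _ _ => x) (fun _ y _ => y)
    (fun _ _ z => z) ->
  affine_rel A.
Proof.
move=> genA depxy depxz dep_xz dep_yz depxyz.
have [//|hypA] := bilinear_rel genA depxy; exfalso.
have [affxz|] := bilinear_rel (generic_swap genA) (dependent_swap depxz).
  exact: affine_not_hyperbolic genA hypA affxz dep_xz.
move=> [e [d [l [l_neq0 hypz]]]]; have [c [b [k [k_neq0 hypy]]]] := hypA.
have c_eq_e : c = e.
  apply: (hyperbolic_poles_eq genA k_neq0 l_neq0 hypy _ depxyz) => x y z.
  exact: hypz.
subst e; apply: (@affine_not_hyperbolic (fun y x z => A x y z)).
- by move=> s2 s1 s3; have [x [y [z []]]] := genA s1 s2 s3; exists y, x, z.
- by exists b, c, k; split=> // y x z /hypy <-; rewrite mulrC.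
(* Dividing [(x - c) * (z - d) = l] by [(x - c) * (y - b) = k] eliminates [x]. *)
- exists (l / k), (d - l / k * b); split=> [|y z x Axyz].
    by rewrite mulf_neq0 ?invr_eq0.
  have xc_neq0 : x - c != 0.
    by apply: contraNneq l_neq0 => xc; rewrite -(hypz _ _ _ Axyz) xc mul0r.
  apply: (mulfI xc_neq0); apply/eqP; rewrite -subr_eq0; apply/eqP.
  have -> : (x - c) * z - (x - c) * (l / k * y + (d - l / k * b)) =
    (x - c) * (z - d) - l / k * ((x - c) * (y - b)) by ring.
  by rewrite (hypz _ _ _ Axyz) (hypy _ _ _ Axyz); field.
have [c0 [c1 [c2 [c3 [c_neq0 cA]]]]] := dep_yz.
by exists c0, c1, c2, c3; split=> // y x z; exact: cA.
Qed.

End AffineRelation.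

(** * Dependences forced by the rank *)

(** By dimension, the row space of [M] meets the span of the [k] selected coordinate forms; a common
    nonzero form vanishes on the kernel of [M]. *)
Lemma rank_dependent (F : fieldType) (m n k : nat) (M : 'M[F]_(m, n))
    (f : 'I_k -> 'I_n) : injective f -> (n < \rank M + k)%N ->
  exists2 c : 'rV[F]_k, c != 0 &
    forall X : 'cV_n, M *m X = 0 -> \sum_i c 0 i * X (f i) 0 = 0.
Proof.
move=> inj_f rankM; pose S : 'M[F]_(k, n) := rowsub f 1%:M.
have rankS : \rank S = k.
  apply/eqP; apply/row_freeP; exists (colsub f 1%:M).
  apply/matrixP => i j; rewrite mul_rowsub_mx mul1mx !mxE.
  by rewrite (inj_eq inj_f).
have v_neq0 : nz_row (M :&: S)%MS != 0.
  rewrite nz_row_eq0 -mxrank_eq0 -lt0n -(ltn_add2l (\rank (M + S)%MS)) addn0.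
  by rewrite mxrank_sum_cap rankS (leq_ltn_trans (rank_leq_col _)).
set v := nz_row _ in v_neq0.
have /submxP[D vM] : (v <= M)%MS := submx_trans (nz_row_sub _) (capmxSl _ _).
have /submxP[c vS] : (v <= S)%MS := submx_trans (nz_row_sub _) (capmxSr _ _).
exists c => [|X MX]; first by apply: contraNneq v_neq0 => c0; rewrite vS c0 mul0mx.
have : v *m X = 0 by rewrite vM -mulmxA MX mulmx0.
rewrite vS -mulmxA mul_rowsub_mx mul1mx => /matrixP/(_ 0 0); rewrite !mxE => cX0.
by rewrite -[RHS]cX0; apply: eq_bigr => i _; rewrite mxE.
Qed.

(** * The closure equation and the lambda-matrix *)

Section DualQuaternions.
Variable F : comNzRingType.
Implicit Types p q h : dquat F.

(** With the index first, each coordinate is a linear form, and equalities of dual quaternions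
    reduce to identities in [F]. *)
Definition dquat_coordl (n : 'I_8) h : F := dquat_coord h n.

Lemma dquat_coordl_linear n : scalar (dquat_coordl n).
Proof.
by move=> a [[? ? ? ?] [? ? ? ?]] [[? ? ? ?] [? ? ? ?]];
  case: n => -[|[|[|[|[|[|[|[|]]]]]]]].
Qed.

HB.instance Definition _ n := GRing.isLinear.Build F (dquat F) F *%R
  (dquat_coordl n) (dquat_coordl_linear n).

Lemma dquat_coordlP p q :
  (forall n, dquat_coordl n p = dquat_coordl n q) -> p = q.
Proof.
case: p q => [[p0 p1 p2 p3] [p4 p5 p6 p7]] [[q0 q1 q2 q3] [q4 q5 q6 q7]] pq.
have pqn n : (n < 8)%N ->
    [:: p0; p1; p2; p3; p4; p5; p6; p7]`_n =
    [:: q0; q1; q2; q3; q4; q5; q6; q7]`_n.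
  by move=> n8; exact: (pq (Ordinal n8)).
have /= e0 := pqn 0%N isT; have /= e1 := pqn 1%N isT.
have /= e2 := pqn 2%N isT; have /= e3 := pqn 3%N isT.
have /= e4 := pqn 4%N isT; have /= e5 := pqn 5%N isT.
have /= e6 := pqn 6%N isT; have /= e7 := pqn 7%N isT.
by rewrite e0 e1 e2 e3 e4 e5 e6 e7.
Qed.

(** The terms in [a * b * c] cancel; the other coefficients are the entries of a row of the
    lambda-matrix. *)
Lemma closure_expand p1 p2 p3 q1 q2 q3 (a b c : F) :
  (a%:A - p1) * (b%:A - p2) * (c%:A - p3) =
  (c%:A + q3) * (b%:A + q2) * (a%:A + q1) ->
  (a * b) *: (p3 + q3) + (a * c) *: (p2 + q2) + (b * c) *: (p1 + q1)
  + c *: (q2 * q1 - p1 * p2) + b *: (q3 * q1 - p1 * p3)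
  + a *: (q3 * q2 - p2 * p3) + (q3 * q2 * q1 + p1 * p2 * p3) = 0.
Proof.
move=> /esym/eqP; rewrite -subr_eq0 => /eqP <-; apply: dquat_coordlP => n.
rewrite !(mulrDl, mulrDr, mulNr, mulrN, =^~ scalerAl, =^~ scalerAr, mul1r, mulr1,
  opprK, opprD, scalerDr, scalerN, scalerA).
by rewrite !(linearD, linearN, linearZ) /=; ring.
Qed.

Lemma mul_conj_factor h (a : F) : h ^+ 2 = -1 ->
  (a%:A + h) * (a%:A - h) = (a ^+ 2 + 1)%:A.
Proof.
rewrite expr2 => hh; rewrite mulrBr !mulrDl hh -!scalerAl !mul1r -scalerAr mulr1.
by rewrite scalerA -expr2 scalerDl scale1r opprD opprK addrA addrK.
Qed.

End DualQuaternions.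

(* Multiplying by [a + p1] on the left and [a - q1] on the right moves the first
   joint to the end of the loop: row i of the lambda-matrix becomes row i + 1. *)
Lemma closure_shift (F : fieldType) (p1 p2 p3 q1 q2 q3 : dquat F) (a b c : F) :
  p1 ^+ 2 = -1 -> q1 ^+ 2 = -1 -> a ^+ 2 + 1 != 0 ->
  (a%:A - p1) * (b%:A - p2) * (c%:A - p3) =
  (c%:A + q3) * (b%:A + q2) * (a%:A + q1) ->
  (b%:A - p2) * (c%:A - p3) * (a%:A - q1) =
  (a%:A + p1) * (c%:A + q3) * (b%:A + q2).
Proof.
move=> p1sq q1sq a_neq0 /(congr1 (fun u => (a%:A + p1) * u * (a%:A - q1))).
rewrite -!mulrA mul_conj_factor // mulrA mul_conj_factor //.
rewrite mulr_algl mulr_algr -scalerAr -scalerAr !mulrA.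
exact: scalerI.
Qed.

(* In the order of the columns of the lambda-matrix. *)
Definition monomial (F : comNzRingType) (i : nat) (x y z : F) : F :=
  [:: x * y; x * z; y * z; z; y; x; 1]`_i.

Lemma lambda_mx_closure (F : fieldType) (L : 6.-tuple (dquat F)) (x y z : F) :
  is_6R L -> x ^+ 2 + 1 != 0 -> y ^+ 2 + 1 != 0 -> z ^+ 2 + 1 != 0 ->
  (x%:A - axis L 1) * (y%:A - axis L 2) * (z%:A - axis L 3) =
  (z%:A + axis L 6) * (y%:A + axis L 5) * (x%:A + axis L 4) ->
  forall i, \sum_(j < 7) monomial j x y z *: lambda_mx L i j = 0.
Proof.
move=> L6R x_neq0 y_neq0 z_neq0 row1.
have sq (i : nat) : (i.-1 < 6)%N -> axis L i ^+ 2 = -1.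
  by move=> i6; rewrite -(L6R (Ordinal i6)) (tnth_nth 0).
have row2 := closure_shift (sq 1%N isT) (sq 4%N isT) x_neq0 row1.
have row3 := closure_shift (sq 2%N isT) (sq 5%N isT) y_neq0 row2.
have row4 := closure_shift (sq 3%N isT) (sq 6%N isT) z_neq0 row3.
(* From the fourth axis on the parameters repeat, since opposite joints have equal angles. *)
have row5 := closure_shift (sq 4%N isT) (sq 1%N isT) x_neq0 row4.
have row6 := closure_shift (sq 5%N isT) (sq 2%N isT) y_neq0 row5.
rewrite /lambda_mx; move: {L6R sq} (axis L 1) (axis L 2) (axis L 3) (axis L 4)
  (axis L 5) (axis L 6) row1 row2 row3 row4 row5 row6.
move=> h1 h2 h3 h4 h5 h6 row1 row2 row3 row4 row5 row6 i.
under eq_bigr => j _ do rewrite mxE.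
rewrite /monomial !big_ord_recl big_ord0.
case: i => -[|[|[|[|[|[|//]]]]]] i6 /=;
  [ rewrite -[RHS](closure_expand row1) | rewrite -[RHS](closure_expand row2)
  | rewrite -[RHS](closure_expand row3) | rewrite -[RHS](closure_expand row4)
  | rewrite -[RHS](closure_expand row5) | rewrite -[RHS](closure_expand row6) ];
  (* The shifts permute the monomials, so the two sums are compared coordinate by coordinate. *)
  apply: dquat_coordlP => n;
  by rewrite !(linearD, linearN, linearZ) /= linear0; ring.
Qed.

Lemma coord_mx_kernel (F : comNzRingType) (m n : nat) (M : 'M[dquat F]_(m, n))
    (X : 'cV_n) :
  (forall i, \sum_j X j 0 *: M i j = 0) -> coord_mx M *m X = 0.
Proof.
move=> MX; rewrite /coord_mx mxcol_mul -[RHS](@mxcol0 _ _ (fun=> 8%N)).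
apply/eq_mxcolP => i; apply/matrixP => k j; rewrite !mxE ord1.
have := congr1 (dquat_coordl k) (MX i); rewrite linear_sum linear0 => coord0.
by rewrite -[RHS]coord0; apply: eq_bigr => l _; rewrite mxE linearZ /= mulrC.
Qed.

(** Four forms among seven always meet a row space of dimension four, because [4 + 4 > 7]. *)
Lemma monomials_dependent (F : fieldType) (A : F -> F -> F -> Prop) (m : nat)
    (M : 'M[F]_(m, 7)) (i0 i1 i2 i3 : nat) :
  \rank M = 4%N ->
  (forall x y z, A x y z -> M *m \col_(j < 7) monomial j x y z = 0) ->
  uniq [:: i0; i1; i2; i3] -> all (gtn 7) [:: i0; i1; i2; i3] ->
  dependent A (monomial i0) (monomial i1) (monomial i2) (monomial i3).
Proof.
move=> rankM MA; set s := [:: i0; i1; i2; i3] => uniq_s s_lt7.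
pose f (k : 'I_4) : 'I_7 := inord (nth 0%N s k).
have fE k : f k = nth 0%N s k :> nat.
  by rewrite inordK //; apply: (allP s_lt7); rewrite mem_nth.
have inj_f : injective f.
  move=> k l /(congr1 val); rewrite /= !fE => /eqP.
  by rewrite nth_uniq // => /eqP/val_inj.
have [|c c_neq0 cM] := rank_dependent (M := M) inj_f; first by rewrite rankM.
exists (c 0 0), (c 0 1), (c 0 (inord 2)), (c 0 (inord 3)); split.
  move=> [c0 c1 c2 c3]; move/eqP: c_neq0; apply; apply/rowP => k.
  rewrite mxE; case: k => -[|[|[|[|//]]]] k4.
  - by rewrite -[RHS]c0; congr (c 0 _); exact: val_inj.
  - by rewrite -[RHS]c1; congr (c 0 _); exact: val_inj.
  - by rewrite -[RHS]c2; congr (c 0 _); apply: val_inj; rewrite /= inordK.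
  - by rewrite -[RHS]c3; congr (c 0 _); apply: val_inj; rewrite /= inordK.
move=> x y z /MA/cM; rewrite !big_ord_recl big_ord0 !mxE !fE /= addr0 !addrA.
move=> cM0; rewrite -[RHS]cM0; congr (_ * _ + _ * _ + _ * _ + _ * _);
  congr (c 0 _); apply: val_inj.
- by [].
- by rewrite /= inordK.
- by rewrite /= inordK.
Qed.

(** * Closed and irreducible sets in the cube of projective lines *)

Section Zariski.
Variable F : fieldType.
Implicit Type s : seq (P1 F).

(** For [p] of degree at most [d], this is the homogenization of [p] in degree [d]. *)
Definition binary_form (d : nat) (p : {poly F}) (t : P1 F) : F :=
  let: (x, y) := hcoord t in \sum_(i < d.+1) p`_i * (x ^+ i * y ^+ (d - i)).

Lemma binary_formE d (p : {poly F}) (t : P1 F) : (size p <= d.+1)%N ->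
  binary_form d p t = if t is Some x then p.[x] else p`_d.
Proof.
move=> szp; case: t => [x|]; rewrite /binary_form /=.
  by rewrite (horner_coef_wide _ szp); apply: eq_bigr => i _; rewrite expr1n mulr1.
rewrite big_ord_recr /= subnn expr1n expr0 !mulr1 big1 ?add0r // => i _.
by rewrite expr0n subn_eq0 leqNgt ltn_ord !mulr0.
Qed.

Lemma zariski_closed_product d1 d2 d3 (p q r : {poly F}) :
  zariski_closed [set t : P1cube F | binary_form d1 p t.1.1
    * binary_form d2 q t.1.2 * binary_form d3 r t.2 = 0].
Proof.
pose c i j k := p`_i * q`_j * r`_k.
have evalE (t : P1cube F) : triform_eval (d1, d2, d3) c t =
    binary_form d1 p t.1.1 * binary_form d2 q t.1.2 * binary_form d3 r t.2.
  rewrite /triform_eval /binary_form.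
  case: (hcoord _) => x1 y1; case: (hcoord _) => x2 y2; case: (hcoord _) => x3 y3 /=.
  rewrite !mulr_suml; apply: eq_bigr => i _.
  rewrite [X in _ = X * _]mulr_sumr mulr_suml; apply: eq_bigr => j _.
  by rewrite mulr_sumr; apply: eq_bigr => k _; rewrite /c; ring.
exists [set ((d1, d2, d3), c)]; apply/seteqP; split=> t /=.
  by move=> t0 _ ->; rewrite evalE.
by move=> /(_ _ erefl); rewrite evalE.
Qed.

(** A finite list is the zero set of a form whose degree is its length: the finite members are the
    roots, and each [None] lowers the degree of the polynomial, which makes the form vanish at
    infinity. *)
Lemma zariski_closed_mem s1 s2 s3 :
  zariski_closed
    [set t : P1cube F | [|| t.1.1 \in s1, t.1.2 \in s2 | t.2 \in s3]].
Proof.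
pose p s : {poly F} := \prod_(c <- pmap id s) ('X - c%:P).
have sz_p s : size (p s) = (count isSome s).+1.
  by rewrite size_prod_XsubC size_pmap.
have formE s (t : P1 F) : (binary_form (size s) (p s) t == 0) = (t \in s).
  rewrite binary_formE ?sz_p ?ltnS ?count_size //.
  case: t => [x|]; first by rewrite -rootE root_prod_XsubC mem_pmap map_id.
  have [/allP all_s|] := boolP (all isSome s).
    have -> : None \in s = false by apply/negP => /all_s.
    have := monic_prod_XsubC (pmap id s) predT id; rewrite -/(p s).
    rewrite monicE lead_coefE sz_p /=.
    move/allP: all_s; rewrite all_count => /eqP -> /eqP ->.
    by rewrite oner_eq0.
  move=> not_all; have -> : None \in s.
    by move: not_all; rewrite -has_predC => /hasP[[]].
  rewrite nth_default ?eqxx // sz_p ltn_neqAle count_size andbT.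
  by rewrite -all_count.
have -> : [set t : P1cube F | [|| t.1.1 \in s1, t.1.2 \in s2 | t.2 \in s3]] =
    [set t | binary_form (size s1) (p s1) t.1.1
      * binary_form (size s2) (p s2) t.1.2
      * binary_form (size s3) (p s3) t.2 = 0].
  apply/seteqP; split=> t /=; rewrite -!formE -!mulf_eq0 mulrA => /eqP //.
exact: zariski_closed_product.
Qed.

(** Planes are split off the cover one at a time: by irreducibility [K] lies in that plane or in the
    rest. The empty cover contradicts [K] being nonempty. *)
Lemma irreducible_cover_const (K : set (P1cube F)) s1 s2 s3 :
  irreducible_set (@zariski_closed F) K ->
  K `<=` [set t | [|| t.1.1 \in s1, t.1.2 \in s2 | t.2 \in s3]] ->
  [\/ exists c, forall t, K t -> t.1.1 = c,
      exists c, forall t, K t -> t.1.2 = c |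
      exists c, forall t, K t -> t.2 = c].
Proof.
move=> [[t0 Kt0] irrK].
elim: s1 => [|c s1 IH1]; [elim: s2 => [|c s2 IH2]; [elim: s3 => [|c s3 IH3]|]|].
- by move=> /(_ _ Kt0).
- move=> Kcover.
  have [| |] := irrK _ _ (zariski_closed_mem [::] [::] [:: c])
    (zariski_closed_mem [::] [::] s3).
  + move=> t /Kcover /=; rewrite !in_cons !in_nil /= => /orP[->|->].
      by left.
    by right.
  + by move=> Kc; constructor 3; exists c => t /Kc /=; rewrite !inE => /eqP.
  + exact: IH3.
- move=> Kcover.
  have [| |] := irrK _ _ (zariski_closed_mem [::] [:: c] [::])
    (zariski_closed_mem [::] s2 s3).
  + move=> t /Kcover /=; rewrite !in_cons !in_nil /= -orbA => /orP[->|->].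
      by left.
    by right.
  + move=> Kc; constructor 2; exists c => t /Kc /=.
    by rewrite !inE orbF => /eqP.
  + exact: IH2.
- move=> Kcover.
  have [| |] := irrK _ _ (zariski_closed_mem [:: c] [::] [::])
    (zariski_closed_mem s1 s2 s3).
  + move=> t /Kcover /=; rewrite !in_cons !in_nil /= -orbA => /orP[->|->].
      by left.
    by right.
  + move=> Kc; constructor 1; exists c => t /Kc /=.
    by rewrite !inE !orbF => /eqP.
  + exact: IH1.
Qed.

Lemma irreducible_generic (K : set (P1cube F)) :
  irreducible_set (@zariski_closed F) K ->
  ~ (exists c, forall t, K t -> t.1.1 = c) ->
  ~ (exists c, forall t, K t -> t.1.2 = c) ->
  ~ (exists c, forall t, K t -> t.2 = c) ->
  generic (fun x y z => K (Some x, Some y, Some z)).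
Proof.
move=> irrK nc1 nc2 nc3 s1 s2 s3; apply: contrapT => no_point.
(* Adding [None] makes the cover include all points with a coordinate at infinity. *)
pose inf (s : seq F) : seq (P1 F) := None :: map Some s.
have [|/nc1//|/nc2//|/nc3//] :=
  @irreducible_cover_const K (inf s1) (inf s2) (inf s3) irrK.
move=> [[t1 t2] t3] Kt /=; apply/negPn/negP.
case: t1 t2 t3 Kt => [x|] [y|] [z|] Kt; rewrite /inf ?in_cons ?orbT //=.
rewrite !(mem_map (@Some_inj _)) !negb_or => /and3P[x_s1 y_s2 z_s3].
by apply: no_point; exists x, y, z.
Qed.

End Zariski.

(** * Linear polynomials with dual quaternion coefficients *)

(* Stated over an abstract ring: on [{poly dquat F}], the rewriting rules for
   polynomials make unification unfold the dual quaternion operations. *)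
Section LinearPolynomial.
Variable A : nzRingType.
Implicit Types u v x : A.

(** Conjugation reverses products, so only compatibility with subtraction and [1] is asked of
    [f]. *)
Lemma map_XsubCC (f : A -> A) u v : {morph f : x y / x - y} -> f 1 = 1 ->
  map_poly f ('X - u%:P - v%:P) = 'X - (f u)%:P - (f v)%:P.
Proof.
move=> fB f1; have f0 : f 0 = 0 by have := fB 0 0; rewrite !subrr.
apply/polyP => i; rewrite coef_map_id0 // !coefB !coefX !coefC !fB.
by case: i => [|[|i]] /=; rewrite ?f0 ?f1.
Qed.

Lemma horner_XsubCC u v x : ('X - u%:P - v%:P).[x] = x - u - v.
Proof. by rewrite !hornerE. Qed.

Lemma mul_XsubCC u v : (forall w, u * w = w * u) ->
  ('X - u%:P - v%:P) * ('X - u%:P - (- v)%:P) = ('X - u%:P) ^+ 2 - (v ^+ 2)%:P.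
Proof.
move=> comm_u; have commX (p : {poly A}) : ('X - u%:P) * p = p * ('X - u%:P).
  rewrite mulrBl mulrBr commr_polyX; congr (_ - _).
  by apply/polyP => i; rewrite coefCM coefMC comm_u.
move: ('X - u%:P) commX => Y commX.
by rewrite polyCN opprK mulrBl !mulrDr (commX v%:P) -expr2 opprD addrA addrK polyCM.
Qed.

End LinearPolynomial.

(** A nonzero scalar part [a] would force [b = c = d = 0] and [a * a = -1]; a nonzero dual scalar
    part [e] would then force the primal part to vanish. So [h] has no scalar parts. *)
Lemma conj_sqrN1 (R : realFieldType) (h : dquat R) : h ^+ 2 = -1 ->
  dquat_conj h = - h.
Proof.
case: h => [[a b c d] [e f g k]]; rewrite expr2 => -[E1 E2 E3 E4 E5 E6 E7 E8].
have a0 : a = 0.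
  apply/eqP/negPn/negP => a_neq0.
  have a2_neq0 : a *+ 2 != 0 by rewrite mulrn_eq0.
  have b0 : b = 0 by apply: (mulfI a2_neq0); rewrite mulr0 -[RHS]oppr0 -E2; ring.
  have c0 : c = 0 by apply: (mulfI a2_neq0); rewrite mulr0 -[RHS]oppr0 -E3; ring.
  have d0 : d = 0 by apply: (mulfI a2_neq0); rewrite mulr0 -[RHS]oppr0 -E4; ring.
  have := sqr_ge0 a; rewrite expr2.
  have -> : a * a = -1 by rewrite -E1 b0 c0 d0; ring.
  by rewrite oppr_ge0 ler10.
subst a.
have e0 : e = 0.
  apply/eqP/negPn/negP => e_neq0.
  have e2_neq0 : e *+ 2 != 0 by rewrite mulrn_eq0.
  have b0 : b = 0 by apply: (mulfI e2_neq0); rewrite mulr0 -[RHS]oppr0 -E6; ring.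
  have c0 : c = 0 by apply: (mulfI e2_neq0); rewrite mulr0 -[RHS]oppr0 -E7; ring.
  have d0 : d = 0 by apply: (mulfI e2_neq0); rewrite mulr0 -[RHS]oppr0 -E8; ring.
  move: E1; rewrite b0 c0 d0 !mul0r !subr0 => /esym/eqP.
  by rewrite oppr_eq0 oner_eq0.
by subst e; congr DQuat; congr Quat; rewrite oppr0.
Qed.

Definition axis_poly (F : comNzRingType) (a b : F) (h : dquat F) :
    {poly dquat F} :=
  'X - (a%:A)%:P - (b *: h)%:P.

(** Evaluation at the central element [x%:A] is multiplicative, although the coefficients do not
    commute. *)
Lemma horner_axis_poly_mul (F : comNzRingType) (p : {poly dquat F}) (a b x : F) h :
  (p * axis_poly a b h).[x%:A] = p.[x%:A] * ((x - a)%:A - b *: h).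
Proof.
rewrite hornerM_comm /axis_poly ?horner_XsubCC ?scalerBl //.
by rewrite /comm_poly mulr_algl mulr_algr.
Qed.

Lemma horner_axis_poly3 (F : comNzRingType) (a b c a' b' c' x : F) h k l :
  (axis_poly a a' h * axis_poly b b' k * axis_poly c c' l).[x%:A] =
  ((x - a)%:A - a' *: h) * ((x - b)%:A - b' *: k) * ((x - c)%:A - c' *: l).
Proof.
rewrite -[axis_poly a a' h]mul1r !horner_axis_poly_mul.
by rewrite (hornerC (1 : dquat F)) mul1r.
Qed.

Lemma map_conj_axis_poly (F : comNzRingType) (a b : F) (h : dquat F) :
  map_poly (@dquat_conj F) (axis_poly a b h) = axis_poly a b (dquat_conj h).
Proof.
have conjB : {morph @dquat_conj F : x y / x - y}.
  by move=> x y; congr DQuat; congr Quat => /=; ring.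
have conj1 : dquat_conj (1 : dquat F) = 1.
  by congr DQuat; congr Quat => /=; ring.
have conjA : dquat_conj (a%:A : dquat F) = a%:A.
  by congr DQuat; congr Quat => /=; ring.
have conjZ : dquat_conj (b *: h) = b *: dquat_conj h.
  by congr DQuat; congr Quat => /=; ring.
have := map_XsubCC (a%:A : dquat F) (b *: h) conjB conj1.
by rewrite conjA conjZ.
Qed.

Lemma axis_poly_norm (R : realFieldType) (a b : R) (h : dquat R) :
  h ^+ 2 = -1 ->
  axis_poly a b h * map_poly (@dquat_conj R) (axis_poly a b h) =
  ('X - (a%:A)%:P) ^+ 2 - ((b ^+ 2) *: -1)%:P.
Proof.
move=> hh; rewrite map_conj_axis_poly (conj_sqrN1 hh) /axis_poly scalerN mul_XsubCC.
  by rewrite exprZn hh.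
by move=> w; rewrite mulr_algl mulr_algr.
Qed.

(** The norm [(X - a)^2 + b^2] depends neither on the axis nor on the sign of [b]. *)
Lemma axis_poly_norm_opp (R : realFieldType) (a b : R) (h k : dquat R) :
  h ^+ 2 = -1 -> k ^+ 2 = -1 ->
  axis_poly a b h * map_poly (@dquat_conj R) (axis_poly a b h) =
  axis_poly a (- b) k * map_poly (@dquat_conj R) (axis_poly a (- b) k).
Proof.
move=> hh kk; apply: etrans (axis_poly_norm a b hh) _.
by rewrite -(sqrrN b); apply/esym; exact: axis_poly_norm.
Qed.

Lemma dquat_infinite_roots_eq0 (F : idomainType) (S : F -> Prop)
    (D : {poly dquat F}) :
  infinite_pred S -> (forall x, S x -> D.[x%:A] = 0) -> D = 0.
Proof.
move=> infS D_S; apply/polyP => i; apply: dquat_coordlP => n; rewrite coef0 linear0.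
(* As [x] is a scalar, the [n]-th coordinate of [D.[x%:A]] is [q.[x]]. *)
pose q : {poly F} := \poly_(j < size D) dquat_coordl n D`_j.
have q0 : q = 0.
  apply: (infinite_roots_eq0 infS) => x Sx; rewrite /q horner_poly.
  have := congr1 (dquat_coordl n) (D_S x Sx).
  rewrite linear0 horner_coef linear_sum => Dx0; rewrite -[RHS]Dx0.
  apply: eq_bigr => j _.
  by rewrite exprZn expr1n mulr_algr linearZ /= mulrC.
have := coef_poly (size D) (fun j => dquat_coordl n D`_j) i.
rewrite -/q q0 coef0; case: ltnP => // szD _.
by rewrite nth_default // linear0.
Qed.

Lemma dquat_poly_eq (F : idomainType) (S : F -> Prop) (D E : {poly dquat F}) :
  infinite_pred S -> (forall x, S x -> D.[x%:A] = E.[x%:A]) -> D = E.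
Proof.
move=> infS DE; apply/eqP; rewrite -subr_eq0; apply/eqP.
by apply: (dquat_infinite_roots_eq0 infS) => x /DE; rewrite hornerD hornerN => ->;
  rewrite subrr.
Qed.

(** * From affine relations to the cubic factorization *)

Lemma sqrD1_neq0 (R : realDomainType) (x : R) : x ^+ 2 + 1 != 0.
Proof. by rewrite lt0r_neq0 // ltr_wpDl ?ltr01 ?sqr_ge0. Qed.

Lemma K_sym_plus_closure (F : comNzRingType) (L : 6.-tuple (dquat F)) (x y z : F) :
  K_sym_plus L (Some x, Some y, Some z) ->
  (x%:A - axis L 1) * (y%:A - axis L 2) * (z%:A - axis L 3) =
  (z%:A + axis L 6) * (y%:A + axis L 5) * (x%:A + axis L 4).
Proof. by case=> _ /=; rewrite !opprK. Qed.

Lemma cubic_of_affine (R : realType) (L : 6.-tuple (dquat R))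
    (A : R -> R -> R -> Prop) :
  is_6R L -> generic A ->
  (forall x y z, A x y z -> K_sym_plus L (Some x, Some y, Some z)) ->
  affine_rel A -> affine_rel (fun x z y => A x y z) ->
  cubic_polynomial_type L.
Proof.
move=> L6R genA A_sub [p [q [p_neq0 Ay]]] [u [v [u_neq0 Az]]].
have sq (i : nat) : (i.-1 < 6)%N -> axis L i ^+ 2 = -1.
  by move=> i6; rewrite -(L6R (Ordinal i6)) (tnth_nth 0).
(* From [y = p x + q] follows [(y - h2) / p = x + q / p - h2 / p], and similarly for [z]. The
   factors [t + h] on the right of the closure equation account for the opposite signs in the last
   three [b_i]. *)
exists [tuple 0; - (q / p); - (v / u); 0; - (q / p); - (v / u)].
exists [tuple 1; p^-1; u^-1; -1; - p^-1; - u^-1] => r N.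
split.
- move=> i; rewrite (tnth_nth 0).
  by case: i => -[|[|[|[|[|[|//]]]]]] i6 /=; rewrite ?oppr_eq0 ?oner_eq0 ?invr_eq0.
- change (axis_poly 0 1 (axis L 1) * axis_poly (- (q / p)) p^-1 (axis L 2)
      * axis_poly (- (v / u)) u^-1 (axis L 3) =
    axis_poly (- (v / u)) (- u^-1) (axis L 6)
      * axis_poly (- (q / p)) (- p^-1) (axis L 5) * axis_poly 0 (- 1) (axis L 4)).
  apply: (@dquat_poly_eq _ (fun x => exists y z, A x y z)).
    move=> s; have [x [y [z [Axyz x_s _ _]]]] := genA s [::] [::].
    by exists x => //; exists y, z.
  move=> x [y [z Axyz]].
  have yE : x - - (q / p) = p^-1 * y by rewrite (Ay _ _ _ Axyz); field.
  have zE : x - - (v / u) = u^-1 * z by rewrite (Az _ _ _ Axyz); field.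
  apply: etrans (horner_axis_poly3 _ _ _ _ _ _ _ _ _ _) _.
  apply: etrans _ (esym (horner_axis_poly3 _ _ _ _ _ _ _ _ _ _)).
  (* Both sides become [(p u)^-1] times those of the closure equation. *)
  rewrite subr0 yE zE !scaleNr !opprK !scale1r -!scalerA.
  rewrite -!scalerBr -!scalerDr -!scalerAl -!scalerAr -!scalerAl !scalerA.
  by rewrite (K_sym_plus_closure (A_sub _ _ _ Axyz)) [u^-1 * _]mulrC.
- exact: axis_poly_norm_opp (sq 1%N isT) (sq 4%N isT).
- exact: axis_poly_norm_opp (sq 2%N isT) (sq 5%N isT).
- exact: axis_poly_norm_opp (sq 3%N isT) (sq 6%N isT).
Qed.

(** * Application to the affine points of [K0] *)

Unset Implicit Arguments.

Theorem theorem4 (R : realType) (L : 6.-tuple (dquat R)) (K0 : set (P1cube R))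
    (L6R : is_6R L)
    (Lsym : angle_symmetric L)
    (dimC : krull_dim_lt (@zariski_closed R[i]) (K_sym (complexify L)) 2)
    (K0comp : nondegenerate_component L K0)
    (K0plus : K0 `<=` K_sym_plus L)
    (K0init : K0 (None, None, None))
    (rank4 : \rank (coord_mx (lambda_mx L)) = 4%N) :
  cubic_polynomial_type L.
Proof.
have [[_ irrK0 _] _ nc1 nc2 nc3] := K0comp.
have genA := irreducible_generic irrK0 nc1 nc2 nc3.
set A := (fun x y z => _) in genA.
have A_sub x y z : A x y z -> K_sym_plus L (Some x, Some y, Some z) by exact: K0plus.
have A_dep i0 i1 i2 i3 : uniq [:: i0; i1; i2; i3] ->
    all (gtn 7) [:: i0; i1; i2; i3] ->
    dependent A (monomial i0) (monomial i1) (monomial i2) (monomial i3).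
  apply: (monomials_dependent rank4) => x y z Axyz; apply: coord_mx_kernel => i.
  under eq_bigr => j _ do rewrite mxE.
  apply: lambda_mx_closure; rewrite ?sqrD1_neq0 //.
  exact: K_sym_plus_closure (A_sub _ _ _ Axyz).
(* Exchanging [y] and [z] requires the product as [z * y], which is not convertible to [y * z]. *)
have A_dep_swap : dependent (fun x z y => A x y z) (fun _ _ _ => 1)
    (fun _ z _ => z) (fun x _ _ => x) (fun _ z y => z * y).
  have [c0 [c1 [c2 [c3 [c_neq0 cA]]]]] := A_dep 6%N 3%N 5%N 2%N isT isT.
  exists c0, c1, c2, c3; split=> // x z y Axyz.
  by rewrite [z * y]mulrC; exact: cA Axyz.
apply: (cubic_of_affine L6R genA A_sub).
(* The indices 0 to 6 stand for [x y, x z, y z, z, y, x, 1]. *)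
- apply: (affine_rel_of_dependent genA).
  + exact: (A_dep 6%N 5%N 4%N 0%N).
  + exact: (A_dep 6%N 5%N 3%N 1%N).
  + exact: (A_dep 6%N 5%N 4%N 1%N).
  + exact: (A_dep 6%N 4%N 5%N 2%N).
  + exact: (A_dep 6%N 5%N 4%N 3%N).
(* The same criterion with [y] and [z] exchanged makes [z] affine in [x]. *)
- apply: (affine_rel_of_dependent (generic_swap genA)).
  + exact: dependent_swap (A_dep 6%N 5%N 3%N 1%N isT isT).
  + exact: dependent_swap (A_dep 6%N 5%N 4%N 0%N isT isT).
  + exact: dependent_swap (A_dep 6%N 5%N 3%N 0%N isT isT).
  + exact: A_dep_swap.
  + exact: dependent_swap (A_dep 6%N 5%N 3%N 4%N isT isT).
Qed.
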